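(* If $\mathcal H$ is a ($d$-uniform) chordal hypergraph, then the Stanley–Reisner ideal $I_{\Delta(\mathcal H)}$ of its clique complex has linear quotients.
   Context: A hypergraph $\mathcal H$ consists of a finite vertex set $\mathcal X(\mathcal H)$ and a finite collection $\mathcal E(\mathcal H)$ of subsets, called edges; it is $d$-uniform if every edge has cardinality $d$. All hypergraphs are simple (every edge has at least two vertices, so $d\ge 2$, and no edge contains another). The $d$-complete hypergraph $K_n^d$ on $n$ vertices has as edges all $d$-subsets of its vertex set; if $n<d$ it consists of $n$ isolated vertices. Chordal hypergraphs are the $d$-uniform hypergraphs obtained inductively as follows: every $K_n^d$ is chordal; and if $\mathcal G$ is chordal, then so is $\mathcal H=\mathcal G\cup_{K_j^d}K_i^d$ for $0\le j<i$, where $K_i^d$ is attached to $\mathcal G$ along a common (under identification) $K_j^d$. The clique complex of a $d$-uniform hypergraph $\mathcal H$ is $\Delta(\mathcal H)=\{F\subseteq\mathcal X(\mathcal H): \text{every } d\text{-subset of } F \text{ is an edge of }\mathcal H\}$ (so every $F$ with $|F|<d$ is a face). For a simplicial complex $\Delta$ on $[n]$ and $R=k[x_1,\dots,x_n]$ ($k$ a field), the Stanley–Reisner ideal is $I_\Delta=(\prod_{i\in F}x_i : F\notin\Delta)$. A monomial ideal $I$ has linear quotients if its minimal monomial generators can be ordered $u_1,\dots,u_t$ so that for each $s$ the colon ideal $(u_1,\dots,u_{s-1}):u_s$ is generated by a set of variables. *)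

(* Defs.v *)
From HB Require Import structures.
From mathcomp Require Import all_boot all_order all_algebra.
From mathcomp Require Import mpoly.

Set Implicit Arguments.
Unset Strict Implicit.
Unset Printing Implicit Defensive.

Import GRing.Theory.
Local Open Scope ring_scope.

Section Hypergraphs.

Variable T : finType.
Implicit Types (S F J e : {set T}) (d : nat).

(* The vertex set is a subset of an ambient finite type, so that hypergraphs   *)
(* with different vertex sets can be glued along their common vertices.        *)
Record hypergraph := Hypergraph {
  vertices : {set T};
  edges : {set {set T}};
  edges_sub : edges \subset powerset vertices
}.

Implicit Types G H K : hypergraph.

Definition uniform d H := forall e, e \in edges H -> #|e| = d.

Definition simple H :=
  (forall e, e \in edges H -> (2 <= #|e|)%N) /\
  (forall e f, e \in edges H -> f \in edges H -> e \subset f -> e = f).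

Definition subhypergraph G H : bool :=
  (vertices G \subset vertices H) && (edges G \subset edges H).

Definition d_subsets d S : {set {set T}} := [set e in powerset S | #|e| == d].

Fact d_subsets_sub d S : d_subsets d S \subset powerset S.
Proof. by apply/subsetP=> e; rewrite inE => /andP[]. Qed.

Definition complete d S : hypergraph := Hypergraph (d_subsets_sub d S).

Fact hunion_sub G K :
  edges G :|: edges K \subset powerset (vertices G :|: vertices K).
Proof.
apply/subsetP=> e; rewrite !inE => /orP[] he.
  by have /subsetP/(_ e he) := edges_sub G; rewrite inE => /subset_trans->;
     rewrite ?subsetUl.
by have /subsetP/(_ e he) := edges_sub K; rewrite inE => /subset_trans->;
   rewrite ?subsetUr.
Qed.

Definition hunion G K : hypergraph := Hypergraph (hunion_sub G K).

(* In [chordal_attach] the identification is carried out by choosing the       *)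
(* vertex set [S] of the attached K_i^d so that it meets that of [G] in        *)
(* exactly [J], the vertex set of a K_j^d contained in [G]; [J \proper S]      *)
(* expresses 0 <= j < i.                                                       *)
Inductive chordal d : hypergraph -> Prop :=
| chordal_complete S : chordal d (complete d S)
| chordal_attach G J S :
    chordal d G ->
    J \proper S ->
    vertices G :&: S = J ->
    subhypergraph (complete d J) G ->
    chordal d (hunion G (complete d S)).

Lemma chordal_uniform d H : chordal d H -> uniform d H.
Proof.
elim=> [S|G J S _ IH _ _ _] e /=; first by rewrite inE => /andP[_ /eqP].
by rewrite inE => /orP[/IH //|]; rewrite inE => /andP[_ /eqP].
Qed.

Lemma uniform_simple d H : (2 <= d)%N -> uniform d H -> simple H.
Proof.
move=> d2 Hd; split=> [e /Hd -> //|e f /Hd he /Hd hf ef].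
by apply/eqP; rewrite eqEcard ef he hf leqnn.
Qed.

Definition clique_complex d H : {set {set T}} :=
  [set F in powerset (vertices H) | d_subsets d F \subset edges H].

End Hypergraphs.

Section Ideals.

Variable R : comNzRingType.
Implicit Types (S I J : R -> Prop) (p q : R).

Definition same_ideal I J := forall p, I p <-> J p.

Definition ideal_gen S : R -> Prop := fun p =>
  exists2 s : seq (R * R),
    (forall c, c \in s -> S c.2) & p = \sum_(c <- s) c.1 * c.2.

Definition colon I q : R -> Prop := fun p => I (p * q).

End Ideals.

Section MonomialIdeals.

Variables (n : nat) (k : fieldType).
Implicit Types (I : {mpoly k[n]} -> Prop) (u v : seq 'X_{1..n}).

Definition monomial_ideal_gen u : {mpoly k[n]} -> Prop :=
  ideal_gen (fun p => exists2 m, m \in u & p = 'X_[m]).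

Definition variable_ideal (Y : {set 'I_n}) : {mpoly k[n]} -> Prop :=
  ideal_gen (fun p => exists2 i, i \in Y & p = 'X_i).

Definition minimal_monomial_generators I u :=
  [/\ uniq u,
      same_ideal I (monomial_ideal_gen u)
    & forall v, {subset v <= u} -> same_ideal I (monomial_ideal_gen v) ->
        {subset u <= v}].

Definition has_linear_quotients I :=
  exists2 u : seq 'X_{1..n}, minimal_monomial_generators I u &
    forall s, (s < size u)%N ->
      exists Y : {set 'I_n},
        same_ideal
          (colon (monomial_ideal_gen (take s u)) 'X_[nth 0%MM u s])
          (variable_ideal Y).

Definition stanley_reisner (Delta : {set {set 'I_n}}) : {mpoly k[n]} -> Prop :=
  ideal_gen (fun p => exists2 F : {set 'I_n},
    F \notin Delta & p = \prod_(i in F) 'X_i).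

End MonomialIdeals.

Arguments stanley_reisner {n} k Delta.

(* Main.v *)
(* Since every vertex set of size less than [d] is a face, the Stanley-Reisner  *)
(* ideal is generated by the squarefree monomials of the [d]-subsets that are   *)
(* not edges. Attaching K_i^d along K_j^d amounts to adding the vertices of     *)
(* S \ J one at a time, each joined to a clique J. The new non-edges are the    *)
(* w |: f with f a (d-1)-subset of the old vertices not contained in J; these   *)
(* are listed before the old non-edges. An old non-edge e is not contained in   *)
(* J, so w |: (e :\ y) is a new one for some y in e, and the colon ideal at e   *)
(* contains the variable of w, which divides every new generator.               *)

Require Import Defs.
From mathcomp Require Import all_boot all_order all_algebra.
From mathcomp Require Import mpoly.

Set Implicit Arguments.
Unset Strict Implicit.
Unset Printing Implicit Defensive.

Import GRing.Theory.

(** For squarefree monomials the colon of $x_a$ by $x_f$ is generated by $x_{a\setminus f}$. Linear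
    quotients thus become a condition on an ordered family of sets: for each $f$ and each earlier
    $a$, some earlier $c$ has $c\setminus f=\{x\}$ with $x\in a$. [colon_mesym1] and
    [squarefree_linear_quotients] carry this translation.

    The combinatorial engine is [set_linear_quotients_vertex]: orders on the link and on the
    deletion of a vertex $w$ combine into an order on the whole family. For the non-edges after
    attaching $w$ to a clique $J$, the deletion is the family of old non-edges, and the link
    consists of the $(d-1)$-subsets not inside $J$, handled by [d_subsets_not_sub_linear_quotients].
    Induction over the attached vertices and then over the construction of the chordal hypergraph
    gives [chordal_nonedges_linear_quotients]. *)

Section LinearQuotientOrders.

Variable T : finType.
Implicit Types (A E F J V X : {set T}).

(** * Linear quotient orders on families of sets *)

Lemma set1U_ind (P : {set T} -> Prop) :
  P set0 -> (forall w A, w \notin A -> P A -> P (w |: A)) -> forall A, P A.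
Proof.
move=> P0 PU A; move: {2}#|A| (erefl #|A|) => m.
elim: m A => [|m IH] A; first by move/cards0_eq->.
move=> cA; have /card_gt0P[w wA] : 0 < #|A| by rewrite cA.
rewrite -(setD1K wA); apply: PU; rewrite ?setD11 //; apply: IH.
by move: cA; rewrite (cardsD1 w) wA => -[].
Qed.

Lemma in_d_subsets k V e : (e \in d_subsets k V) = (e \subset V) && (#|e| == k).
Proof. by rewrite inE powersetE. Qed.

(* For squarefree monomials, [c :\: nth set0 u s = [set x]]     *)
(* says that the colon of [c] by the [s]-th generator is the variable of [x],   *)
(* which must divide [a].                                                      *)
Definition linear_quotient_order (u : seq {set T}) :=
  forall s, s < size u -> forall a, a \in take s u ->
  exists2 c, c \in take s u & exists2 x, x \in a & c :\: nth set0 u s = [set x].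

Definition set_linear_quotients (X : {set {set T}}) :=
  exists u : seq {set T}, [/\ uniq u, u =i X & linear_quotient_order u].

Lemma set_linear_quotients0 : set_linear_quotients set0.
Proof. by exists [::]; split=> // x; rewrite !inE. Qed.

Lemma set_linear_quotients1 e : set_linear_quotients [set e].
Proof.
exists [:: e]; split=> // [x|[|s] //]; first by rewrite !inE.
Qed.

(* The sets containing [w] are listed first: then [w] itself generates the     *)
(* colon ideal at every later set, so only the link needs an order.            *)
Lemma set_linear_quotients_vertex w (X : {set {set T}}) :
  set_linear_quotients [set f : {set T} | (w \notin f) && (w |: f \in X)] ->
  set_linear_quotients [set e : {set T} in X | w \notin e] ->
  (forall e, e \in X -> w \notin e ->
     exists2 f : {set T}, w |: f \in X & f \subset e) ->
  set_linear_quotients X.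
Proof.
move=> [u [uu eu lu]] [v [uv ev lv]] linkX.
have wu f : f \in u -> w \notin f by rewrite eu inE => /andP[].
have wv f : f \in v -> w \notin f by rewrite ev inE => /andP[].
have imE e : (e \in map (setU [set w]) u) = (w \in e) && (e \in X).
  apply/mapP/andP => [[f]|[we eX]].
    by rewrite eu inE => /andP[_ fX] ->; rewrite setU11.
  by exists (e :\ w); rewrite ?setD1K // eu inE setD11 setD1K.
exists (map (setU [set w]) u ++ v); split.
- rewrite cat_uniq uv andbT map_inj_in_uniq ?uu /=.
    by apply/hasPn => e /wv we; rewrite imE (negbTE we).
  by move=> f g /wu wf /wu wg /(congr1 (fun e => e :\ w)); rewrite !setU1K.
- move=> e; rewrite mem_cat imE ev inE.
  by case: (w \in e); rewrite ?andbF ?orbF ?andbT.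
move=> s; rewrite size_cat size_map take_cat nth_cat size_map => ltsuv.
case: ltnP => [ltsu|leus] a.
  rewrite -map_take => /mapP[f fu ->]; rewrite (nth_map set0) //.
  have [c cu [x xf cx]] := lu _ ltsu _ fu.
  exists (w |: c); first exact: map_f.
  exists x; first by rewrite inE xf orbT.
  rewrite -cx; apply/setP=> y; rewrite !inE.
  by case: eqP => //= ->; rewrite (negbTE (wu _ (mem_take cu))) andbF.
have lts : s - size u < size v by rewrite ltn_subLR.
set b := nth _ _ _; have bv : b \in v by apply: mem_nth.
rewrite mem_cat imE => /orP[/andP[wa _]|av].
  have [|f fX fb] := linkX b _ (wv _ bv); first by move: bv; rewrite ev inE => /andP[].
  exists (w |: f); first by rewrite mem_cat imE setU11 fX.
  exists w => //; apply/setP=> y; rewrite !inE.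
  case: eqP => [->|_] /=; first by rewrite (wv _ bv).
  by apply/negP=> /andP[/negP yb /(subsetP fb)].
have [c cv [x xa cx]] := lv _ lts _ av.
by exists c; [rewrite mem_cat cv orbT | exists x].
Qed.

(** * The family of all k-subsets, and of those not contained in J *)

Lemma d_subsets_link k w V : w \notin V ->
  [set f : {set T} | (w \notin f) && (w |: f \in d_subsets k.+1 (w |: V))] = d_subsets k V.
Proof.
move=> wV; apply/setP=> f; rewrite in_set !in_d_subsets.
have [wf|wf] /= := boolP (w \in f).
  by apply/esym/negbTE; apply: contra wV => /andP[/subsetP/(_ w wf)].
by rewrite cardsU1 wf eqSS -{2}(setU1K wV) subsetD1 wf andbT subUset sub1set setU11.
Qed.

Lemma d_subsets_deletion k w V : w \notin V ->
  [set e : {set T} in d_subsets k (w |: V) | w \notin e] = d_subsets k V.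
Proof.
move=> wV; apply/setP=> f; rewrite in_set !in_d_subsets.
by rewrite -{2}(setU1K wV) subsetD1 andbAC.
Qed.

Lemma exists_subset_card1 k (e : {set T}) : #|e| = k.+1 -> exists2 x, x \in e & #|e :\ x| = k.
Proof.
move=> ce; have /card_gt0P[x xe] : 0 < #|e| by rewrite ce.
by exists x => //; move: ce; rewrite (cardsD1 x) xe => -[].
Qed.

(** Pascal's recursion: on adding $w$ to $V$, the link of $w$ is the family of $(k-1)$-subsets of
    $V$ and its deletion the family of $k$-subsets of $V$, so induction on $V$ with $k$ free
    applies. *)
Lemma d_subsets_linear_quotients k V : set_linear_quotients (d_subsets k V).
Proof.
elim/set1U_ind: V k => [|w V wV IH] [|k].
- have -> : d_subsets 0 (set0 : {set T}) = [set set0].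
    by apply/setP=> e; rewrite in_d_subsets inE subset0 cards_eq0 andbb.
  exact: set_linear_quotients1.
- have -> : d_subsets k.+1 (set0 : {set T}) = set0.
    apply/setP=> e; rewrite in_d_subsets inE subset0.
    by apply/negP=> /andP[/eqP->]; rewrite cards0.
  exact: set_linear_quotients0.
- have -> : d_subsets 0 (w |: V) = [set set0].
    apply/setP=> e; rewrite in_d_subsets inE cards_eq0.
    by case: eqP => [->|]; rewrite ?sub0set ?andbF.
  exact: set_linear_quotients1.
apply: (@set_linear_quotients_vertex w).
- by rewrite d_subsets_link.
- by rewrite d_subsets_deletion.
move=> e; rewrite in_d_subsets => /andP[eV /eqP ce] we.
have [x xe cx] := exists_subset_card1 ce.
exists (e :\ x); last exact: subD1set.
rewrite in_d_subsets setUS; last first.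
  apply/subsetP=> y /setD1P[yx ye]; have := subsetP eV _ ye.
  by rewrite !inE => /orP[/eqP yw|//]; rewrite yw (negbTE we) in ye.
by rewrite cardsU1 !inE (negbTE we) andbF cx /=.
Qed.

(** The induction adds only vertices $w$ outside $J$, starting from $V=J$, where the family is
    empty. A set containing such a $w$ is never inside $J$, so the link is the full family of
    $(k-1)$-subsets and only the deletion needs the induction hypothesis. *)
Lemma d_subsets_not_sub_linear_quotients k V J : J \subset V ->
  set_linear_quotients [set f : {set T} in d_subsets k V | ~~ (f \subset J)].
Proof.
move=> JV; rewrite -(setID V J) setIC (setIidPl JV) setUC.
have : J :&: (V :\: J) = set0 by rewrite setIDA setIC -setIDA setDv setI0.
elim/set1U_ind: (V :\: J) => [|w A wA IH] dJ.
  rewrite set0U; have -> : [set f : {set T} in d_subsets k J | ~~ (f \subset J)] = set0.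
    by apply/setP=> f; rewrite in_set in_d_subsets in_set0 andbAC andbN.
  exact: set_linear_quotients0.
have wJ : w \notin J.
  by apply/negP=> wJ; have /setP/(_ w) := dJ; rewrite !inE wJ eqxx.
have dA : J :&: A = set0.
  by apply/eqP; rewrite -subset0 -dJ setIS ?subsetUr.
have wAJ : w \notin A :|: J by rewrite inE negb_or wA.
case: k IH => [|k] IH.
  have -> : [set f : {set T} in d_subsets 0 (w |: A :|: J) | ~~ (f \subset J)] = set0.
    apply/setP=> f; rewrite in_set in_d_subsets in_set0 cards_eq0.
    by case: eqP => [->|]; rewrite ?sub0set ?andbF.
  exact: set_linear_quotients0.
rewrite -setUA; apply: (@set_linear_quotients_vertex w).
- set L := (X in set_linear_quotients X).
  suff -> : L = d_subsets k (A :|: J) by exact: d_subsets_linear_quotients.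
  rewrite -(d_subsets_link _ wAJ); apply/setP=> f; rewrite !in_set; congr (_ && _).
  have -> : (w |: f \subset J) = false by rewrite subUset sub1set (negbTE wJ).
  by rewrite andbT.
- set L := (X in set_linear_quotients X).
  suff -> : L = [set f : {set T} in d_subsets k.+1 (A :|: J) | ~~ (f \subset J)].
    exact: IH.
  rewrite -(d_subsets_deletion _ wAJ); apply/setP=> f; rewrite !in_set.
  by rewrite andbAC.
move=> e; rewrite in_set in_d_subsets => /andP[/andP[eV /eqP ce] eJ] we.
have [x xe cx] := exists_subset_card1 ce.
exists (e :\ x); last exact: subD1set.
rewrite in_set in_d_subsets cardsU1 !inE (negbTE we) andbF cx /= eqxx !andbT.
have -> : (w |: e :\ x \subset J) = false by rewrite subUset sub1set (negbTE wJ).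
by rewrite subUset sub1set setU11 (subset_trans _ eV) ?subD1set.
Qed.

(** * Non-edges after attaching a clique *)

Lemma attach_vertex_linear_quotients d V (E : {set {set T}}) J w :
  1 < d -> E \subset powerset V -> J \subset V -> d_subsets d J \subset E ->
  w \notin V -> set_linear_quotients (d_subsets d V :\: E) ->
  set_linear_quotients (d_subsets d (w |: V) :\: (E :|: d_subsets d (w |: J))).
Proof.
case: d => [|k] //; rewrite ltnS => k_gt0 EV JV JE wV lqV.
have wJ : w \notin J by apply: contra wV; apply: (subsetP JV).
have wE (e : {set T}) : w \in e -> (e \in E) = false.
  move=> we; apply/negbTE; apply: contra wV => /(subsetP EV).
  by rewrite powersetE => /subsetP; apply.
have subU1 (e A : {set T}) : w \notin e -> (e \subset w |: A) = (e \subset A).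
  by move=> we; rewrite -subDset (setDidPl _) // disjoint_sym disjoints1.
have subUU1 (e A : {set T}) : w \notin e -> (w |: e \subset w |: A) = (e \subset A).
  by move=> we; rewrite subUset sub1set setU11 subU1.
apply: (@set_linear_quotients_vertex w).
- set L := (X in set_linear_quotients X).
  (* No set of [E] contains [w], so $w\cup f$ is an edge only when it lies in $w\cup J$, that is,
     when $f\subseteq J$. *)
  suff -> : L = [set f : {set T} in d_subsets k V | ~~ (f \subset J)].
    exact: d_subsets_not_sub_linear_quotients.
  apply/setP=> f; rewrite -(d_subsets_link _ wV) !in_set (wE _ (setU11 _ _)).
  have [//|wf] := boolP (w \in f).
  by rewrite !subUU1 //=; case: (#|_| == _); rewrite ?andbF ?andbT // andbC.
- set L := (X in set_linear_quotients X).
  suff -> : L = d_subsets k.+1 V :\: E by [].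
  apply/setP=> e; rewrite -(d_subsets_deletion _ wV) !in_set.
  have [we|we] := boolP (w \in e); first by rewrite !andbF.
  rewrite !subU1 // !andbT; have [//|eE] := boolP (e \in E).
  suff -> : (e \subset J) && (#|e| == k.+1) = false by [].
  by apply: contraNF eE => eJ; apply: (subsetP JE); rewrite in_d_subsets.
move=> e; rewrite in_setD in_setU negb_or => /andP[/andP[eE _]].
rewrite in_d_subsets => /andP[eV /eqP ce] we.
have [x xe xJ] : exists2 x, x \in e & x \notin J.
  apply/subsetPn; apply: contra eE => eJ.
  by apply: (subsetP JE); rewrite in_d_subsets eJ ce eqxx.
(* Since $d\ge 2$, there is a vertex $y\ne x$ of $e$ to drop; the set $e\setminus y$ keeps $x\notin
   J$, so adding $w$ to it gives a new non-edge. *)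
have /card_gt0P[y] : 0 < #|e :\ x| by move: ce; rewrite (cardsD1 x) xe add1n => -[->].
rewrite !inE => /andP[yx ye].
exists (e :\ y); last exact: subD1set.
have wy : w \notin e :\ y by rewrite inE (negbTE we) andbF.
rewrite in_setD in_setU wE ?setU11 //= !in_d_subsets !subUU1 // cardsU1 wy.
rewrite -ce (cardsD1 y e) ye eqxx !andbT.
have -> /= : e :\ y \subset V.
  by apply: subset_trans (subD1set _ _) _; rewrite -(subU1 e).
rewrite andbT.
by apply/subsetPn; exists x => //; rewrite !inE eq_sym yx.
Qed.

Lemma attach_linear_quotients d V (E : {set {set T}}) J A :
  1 < d -> E \subset powerset V -> J \subset V -> d_subsets d J \subset E ->
  [disjoint A & V] -> set_linear_quotients (d_subsets d V :\: E) ->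
  set_linear_quotients (d_subsets d (A :|: V) :\: (E :|: d_subsets d (A :|: J))).
Proof.
move=> d_gt1 EV JV JE dAV lqV; elim/set1U_ind: A dAV => [|w A wA IH].
  by rewrite !set0U (setUidPl JE).
rewrite disjoints_subset subUset sub1set inE -disjoints_subset => /andP[wV dAV].
have sJ : d_subsets d (A :|: J) \subset d_subsets d (w |: (A :|: J)).
  apply/subsetP=> e; rewrite !in_d_subsets => /andP[eAJ ->].
  by rewrite (subset_trans eAJ) ?subsetUr.
(* The $d$-subsets of $A\cup J$ are already edges, so the next vertex $w$ is attached to the
   enlarged clique $A\cup J$ inside $A\cup V$. *)
rewrite -!setUA -(setUidPr sJ) (setUA E).
apply: attach_vertex_linear_quotients => //.
- rewrite subUset (subset_trans EV) ?powersetS ?subsetUr //=.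
  by rewrite (subset_trans (d_subsets_sub _ _)) // powersetS setUS.
- exact: setUS.
- exact: subsetUr.
- by rewrite inE negb_or wA.
- exact: IH.
Qed.

Lemma chordal_nonedges_linear_quotients d (H : hypergraph T) :
  1 < d -> chordal d H -> set_linear_quotients (d_subsets d (vertices H) :\: edges H).
Proof.
move=> d_gt1; elim=> [S|G J S _ IH _ <- /andP[_ JE]].
  by rewrite setDv; apply: set_linear_quotients0.
have -> : vertices (hunion G (complete d S)) = (S :\: vertices G) :|: vertices G.
  by apply/setP=> x; rewrite !inE; case: (x \in vertices G); rewrite ?orbF.
have -> : edges (hunion G (complete d S))
    = edges G :|: d_subsets d ((S :\: vertices G) :|: (vertices G :&: S)).
  by rewrite (setUC _ (vertices G :&: S)) (setIC _ S) setID.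
apply: attach_linear_quotients => //.
- exact: edges_sub.
- exact: subsetIl.
- by rewrite disjoints_subset subsetDr.
Qed.

End LinearQuotientOrders.

(** * From families of sets to squarefree monomial ideals *)

Section MonomialIdeals.

Variables (n : nat) (k : fieldType).
Implicit Types (m : 'X_{1..n}) (u v : seq 'X_{1..n}) (e f F : {set 'I_n}).
Local Open Scope ring_scope.

Lemma ideal_gen_ext (R : comNzRingType) (S S' : R -> Prop) :
  (forall p, S p <-> S' p) -> same_ideal (ideal_gen S) (ideal_gen S').
Proof. by move=> SS' p; split=> -[s sS ->]; exists s => // c /sS /SS'. Qed.

(** Membership is decided term by term, which reduces the ideal equalities below to divisibility of
    exponents. For the converse, each term $c\,x^m$ is written as $(c\,x^{m-a})\,x^a$. *)
Lemma monomial_ideal_genP u (p : {mpoly k[n]}) :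
  monomial_ideal_gen u p <->
  forall m, m \in msupp p -> exists2 a, a \in u & (a <= m)%MM.
Proof.
split=> [[s sS ->] m /msupp_sum_le /flattenP[ms /mapP[c]]|pu].
  rewrite mem_filter /= => cs ->; have [a au ->] := sS _ cs.
  by rewrite (perm_mem (msuppMX _ _)) => /mapP[m' _ ->]; exists a; rewrite ?lem_addr.
rewrite [p]mpolyE; elim: (msupp p) pu => [|m s IH] pu.
  by exists [::]; rewrite ?big_nil.
have [|t tu et] := IH; first by move=> m' m's; apply: pu; rewrite inE m's orbT.
have [|a au am] := pu m; first exact: mem_head.
exists ((p@_m *: 'X_[m - a], 'X_[a]) :: t).
  by move=> c; rewrite inE => /predU1P[->|/tu //]; exists a.
by rewrite !big_cons et -scalerAl -mpolyXD submK.
Qed.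

Lemma mem_monomial_ideal_genX u m :
  monomial_ideal_gen u ('X_[m] : {mpoly k[n]}) <->
  exists2 a, a \in u & (a <= m)%MM.
Proof.
split=> [/monomial_ideal_genP|[a au am]]; first by apply; rewrite msuppX mem_head.
by apply/monomial_ideal_genP => m'; rewrite msuppX inE => /eqP->; exists a.
Qed.

Lemma variable_ideal_monomial (Y : {set 'I_n}) :
  same_ideal (variable_ideal Y : {mpoly k[n]} -> Prop)
    (monomial_ideal_gen [seq U_(i)%MM | i <- enum Y]).
Proof.
apply: ideal_gen_ext => p; split=> [[i iY ->]|[_ /mapP[i iY ->] ->]].
  by exists U_(i)%MM; rewrite ?map_f ?mem_enum.
by exists i; rewrite // -mem_enum.
Qed.

Lemma prod_mpolyX F : \prod_(i in F) 'X_i = 'X_[mesym1 F] :> {mpoly k[n]}.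
Proof.
rewrite mprodXE; congr 'X_[_]; apply/mnmP=> i; rewrite mnmE mnm_sumE.
have [iF|iF] := boolP (i \in F).
  rewrite (bigD1 i) //= mnm1E eqxx big1 ?addn0 // => j /andP[_ ji].
  by rewrite mnm1E (negbTE ji).
by rewrite big1 // => j jF; rewrite mnm1E; case: eqP jF iF => // -> ->.
Qed.

Lemma stanley_reisner_monomial (Delta : {set {set 'I_n}}) :
  same_ideal (stanley_reisner k Delta)
    (monomial_ideal_gen [seq mesym1 F | F : {set 'I_n} <- enum (~: Delta)]).
Proof.
apply: ideal_gen_ext => p; split=> [[F FD ->]|[_ /mapP[F FD ->] ->]].
  by exists (mesym1 F); rewrite ?prod_mpolyX ?map_f ?mem_enum ?inE.
by exists F; rewrite ?prod_mpolyX //; move: FD; rewrite mem_enum inE.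
Qed.

Lemma mesym1_le e f : (mesym1 e <= mesym1 f)%MM = (e \subset f).
Proof.
apply/mnm_lepP/subsetP=> [ef i ie|ef i]; have := ef i; rewrite !mnmE.
  by rewrite ie; case: (i \in f).
by case: (i \in e) => // ->.
Qed.

Lemma monomial_ideal_gen_eq u v :
  (forall a, a \in u -> exists2 b, b \in v & (b <= a)%MM) ->
  (forall b, b \in v -> exists2 a, a \in u & (a <= b)%MM) ->
  same_ideal (monomial_ideal_gen u : {mpoly k[n]} -> Prop) (monomial_ideal_gen v).
Proof.
move=> uv vu p; split=> /monomial_ideal_genP pI; apply/monomial_ideal_genP => m /pI.
  by case=> a /uv[b bv ba] am; exists b => //; apply: lepm_trans ba am.
by case=> b /vu[a au ab] bm; exists a => //; apply: lepm_trans ab bm.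
Qed.

(** If $x_a$ divides $x^m x_f$, the hypothesis supplies a variable $x$ in $a$ but not in $f$, which
    must divide $x^m$. Conversely, $c\setminus f=\{x\}$ makes $x_c$ divide $x\,x_f$. *)
Lemma colon_mesym1 (w : seq {set 'I_n}) f :
  (forall a, a \in w ->
     exists2 c, c \in w & exists2 x, x \in a & c :\: f = [set x]) ->
  same_ideal (colon (monomial_ideal_gen (map (@mesym1 n) w)) 'X_[mesym1 f])
    (variable_ideal [set x | has (fun c => c :\: f == [set x]) w]
       : {mpoly k[n]} -> Prop).
Proof.
move=> wlq p; set Y := [set _ | _].
have -> : (variable_ideal Y p) <->
    (forall m, m \in msupp p -> exists2 x, x \in Y & (U_(x) <= m)%MM).
  split=> [/variable_ideal_monomial/monomial_ideal_genP pY m /pY|pY].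
    by case=> _ /mapP[x xY ->] xm; exists x; rewrite // -mem_enum.
  apply/variable_ideal_monomial/monomial_ideal_genP => m /pY[x xY xm].
  by exists U_(x)%MM; rewrite ?map_f ?mem_enum.
split=> [/monomial_ideal_genP pI m mp|pY].
  have [|_ /mapP[a aw ->] am] := pI (mesym1 f + m)%MM.
    by rewrite (perm_mem (msuppMX _ _)) map_f.
  have [c cw [x xa cx]] := wlq a aw; exists x.
    by rewrite inE; apply/hasP; exists c; rewrite ?cx.
  have : x \in c :\: f by rewrite cx set11.
  rewrite inE lep1mP -lt0n => /andP[/negbTE xf _].
  by move/mnm_lepP/(_ x): am; rewrite mnmDE !mnmE xa xf.
apply/monomial_ideal_genP => m; rewrite (perm_mem (msuppMX _ _)).
case/mapP=> m' /pY[x]; rewrite inE => /hasP[c cw /eqP cx] xm' ->.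
exists (mesym1 c); first exact: map_f.
apply/mnm_lepP=> i; rewrite mnmDE !mnmE; have /setP/(_ i) := cx; rewrite !inE.
case: (i \in c); case: (i \in f) => //= /esym/eqP ->.
by move: xm'; rewrite lep1mP -lt0n.
Qed.

(** The common cardinality yields minimality of the generators: divisibility between two of them is
    inclusion of sets of equal size, hence equality. *)
Lemma squarefree_linear_quotients d (X : {set {set 'I_n}}) :
  (forall e, e \in X -> #|e| = d) -> set_linear_quotients X ->
  has_linear_quotients
    (monomial_ideal_gen [seq mesym1 e | e : {set 'I_n} <- enum X] :
       {mpoly k[n]} -> Prop).
Proof.
move=> Xd [u [uu eu lu]]; exists (map (@mesym1 n) u); last first.
  move=> s; rewrite size_map => su.
  rewrite -map_take (nth_map set0) //; eexists; apply: colon_mesym1.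
  exact: lu.
have mapE : [seq mesym1 e | e : {set 'I_n} <- enum X] =i map (@mesym1 n) u.
  by apply: eq_mem_map => e; rewrite mem_enum eu.
have uX : same_ideal (monomial_ideal_gen [seq mesym1 e | e : {set 'I_n} <- enum X]
    : {mpoly k[n]} -> Prop) (monomial_ideal_gen (map (@mesym1 n) u)).
  by apply: monomial_ideal_gen_eq => a; rewrite ?mapE => au; exists a;
     rewrite ?mapE ?lepm_refl.
split=> //; first by rewrite map_inj_uniq //; apply: inj_mesym1.
move=> v vu Iv _ /mapP[e eX ->].
have /Iv : monomial_ideal_gen [seq mesym1 e | e : {set 'I_n} <- enum X]
    ('X_[mesym1 e] : {mpoly k[n]}).
  by apply/mem_monomial_ideal_genX; exists (mesym1 e); rewrite ?lepm_refl ?mapE ?map_f.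
case/mem_monomial_ideal_genX=> b bv; have /mapP[f fX eb] := vu _ bv.
rewrite eb mesym1_le => fe.
suff -> : e = f by rewrite -eb.
by apply/esym/eqP; rewrite eqEcard fe !Xd -?eu /=.
Qed.

End MonomialIdeals.

(** * The Stanley-Reisner ideal of the clique complex *)

Theorem theorem4p3 (k : fieldType) (n d : nat) (H : hypergraph 'I_n) :
  (2 <= d)%N -> vertices H = [set: 'I_n] -> chordal d H ->
  has_linear_quotients (stanley_reisner k (clique_complex d H)).
Proof.
move=> d_gt1 VH cH.
have := chordal_nonedges_linear_quotients d_gt1 cH; rewrite VH.
set X := _ :\: _ => /squarefree_linear_quotients lqX.
have XP (e : {set 'I_n}) : (e \in X) = (e \notin edges H) && (#|e| == d).
  by rewrite in_setD in_d_subsets subsetT.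
have [|u [uu Iu mu] lu] := lqX k d; first by move=> e; rewrite XP => /andP[_ /eqP].
(* Every non-face contains a $d$-subset that is not an edge, and such a $d$-subset is itself a
   non-face; hence the non-edges in [X] generate the same ideal. *)
have SR : same_ideal (stanley_reisner k (clique_complex d H))
    (monomial_ideal_gen [seq mesym1 e | e : {set 'I_n} <- enum X]).
  move=> p; rewrite (stanley_reisner_monomial _ p); move: p.
  apply: monomial_ideal_gen_eq => a /mapP[F]; rewrite mem_enum => FX ->{a}.
    move: FX; rewrite !inE VH subsetT /= => /subsetPn[e].
    rewrite in_d_subsets => /andP[eF ed] eH.
    by exists (mesym1 e); rewrite ?mesym1_le // map_f // mem_enum XP eH.
  exists (mesym1 F); last exact: lepm_refl.
  move: FX; rewrite XP => /andP[FH Fd]; rewrite map_f // mem_enum !inE VH subsetT /=.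
  by apply/subsetPn; exists F; rewrite // in_d_subsets subxx.
exists u => //; split=> // [p|v vu Iv]; first by rewrite (SR p); apply: Iu.
by apply: mu => // p; rewrite -(SR p).
Qed.
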